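(* Let $f\in H^1(\Omega)$, $\Omega=(0,1)$, let $\widetilde{f^{(n)}}:=E(f\mid\sigma_n)$ be the conditional expectation with respect to the $\sigma$-algebra $\sigma_n$, and let $\tilde F^{(n)}(x)=n\big(\widetilde{f^{(n)}}(x+1/n)-\widetilde{f^{(n)}}(x)\big)$. Then $$\limsup_{n\to\infty}\int_0^{1-\frac1n}|\tilde F^{(n)}(x)|^2dx\ \le\ \int_0^1|f'(x)|^2dx .$$
   Context: $\sigma_n$ is the $\sigma$-algebra on $[0,1]$ generated by the intervals $[\frac{\kappa}{n},\frac{\kappa+1}{n})$, $\kappa=0,\dots,n-2$, and $[\frac{n-1}{n},1]$; conditional expectation is with respect to Lebesgue measure, so $E(f\mid\sigma_n)$ equals $n\int_{\kappa/n}^{(\kappa+1)/n}f(s)\,ds$ on the $\kappa$-th interval. $f'$ is the weak (Sobolev) derivative. *)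

(* Defs.v *)
From HB Require Import structures.
From mathcomp Require Import all_boot all_order all_algebra.
From mathcomp Require Import all_classical all_reals all_analysis.

Set Implicit Arguments.
Unset Strict Implicit.
Unset Printing Implicit Defensive.

Import Order.TTheory GRing.Theory Num.Theory.
Import numFieldNormedType.Exports.

Local Open Scope classical_set_scope.
Local Open Scope ring_scope.

(* L^2(D), for functions on the whole line considered only on D: f \_ D is f
   on D and 0 elsewhere. *)
Definition L2 (R : realType) (D : set R) (f : R -> R) : Prop :=
  (f \_ D) \in Lfun (@lebesgue_measure R) 2%:E.

(* C_c^infty(D), for D open. *)
Definition test_function (R : realType) (D : set R) (phi : R -> R) : Prop :=
  [/\ forall (k : nat) (x : R), derivable (phi^`(k))%classic x 1,
      compact (closure [set x | phi x != 0])
    & closure [set x | phi x != 0] `<=` D].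

Definition weak_derivative (R : realType) (D : set R) (f df : R -> R) : Prop :=
  forall phi : R -> R, test_function D phi ->
    \int[@lebesgue_measure R]_(x in D) (f x * phi^`()%classic x) =
    - \int[@lebesgue_measure R]_(x in D) (df x * phi x).

(* f is in H^1(D) and df is (a representative of) its weak derivative, which
   is determined by f up to a null set. *)
Definition sobolev_H1 (R : realType) (D : set R) (f df : R -> R) : Prop :=
  [/\ L2 D f, L2 D df & weak_derivative D f df].

Definition sigma_cells (R : realType) (n : nat) : set (set R) :=
  [set A : set R |
     (exists2 k : nat, (k.+1 < n)%N & A = `[k%:R / n%:R, k.+1%:R / n%:R[%classic)
     \/ A = `[n.-1%:R / n%:R, 1]%classic].

(* A sigma-algebra on [0, 1] (complements are taken in [0, 1]); only meant for
   0 < n. *)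
Definition sigma_n (R : realType) (n : nat) : set (set R) :=
  <<s `[0, 1], @sigma_cells R n >>.

(* g is a version of E(f | S), where S is a sub-sigma-algebra of the measurable
   subsets of D and mu is restricted to D. *)
Definition is_cond_exp (d : measure_display) (T : measurableType d)
    (R : realType) (mu : {measure set T -> \bar R}) (D : set T)
    (S : set (set T)) (f g : T -> R) : Prop :=
  [/\ preimage_set_system D g measurable `<=` S,
      mu.-integrable D (EFin \o g)
    & forall A : set T, S A ->
        (\int[mu]_(x in A) (g x)%:E = \int[mu]_(x in A) (f x)%:E)%E].

Definition diff_quot (R : realType) (n : nat) (g : R -> R) (x : R) : R :=
  n%:R * (g (x + n%:R^-1) - g x).

(* Main.v *)
Require Import Defs.
From mathcomp Require Import all_boot all_order all_algebra.
From mathcomp Require Import all_classical all_reals all_analysis.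
From mathcomp Require Import measurable_realfun ring lra zify.

(** The inequality holds for every n >= 1, before any limit is taken.

    A version of the conditional expectation is constant on each of the n cells,
    with value the average a_k of f over the k-th cell ([cond_exp_cell]), so the
    squared difference quotient is a step function and its integral is
    n (a_1 - a_0)^2 + ... + n (a_{n-1} - a_{n-2})^2
    ([integral_diff_quot_sqr_le]).

    Let w_k be the tent of height 1 supported by the k-th and the (k+1)-st cells.
    Its derivative is n on the former and -n on the latter, so that
    a_{k+1} - a_k is minus the integral of f w_k', hence the integral of f' w_k
    ([cell_average_diff]).  Since w_k has mass 1/n, the Cauchy-Schwarz inequality
    bounds n (a_{k+1} - a_k)^2 by the integral of f'^2 w_k
    ([sqr_Rintegral_tent]), and since the tents add up to at most 1
    ([sum_tent_le1]) the sum over k is at most the integral of f'^2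
    ([sum_sqr_cell_average_diff]).

    The one analytic difficulty is that tents are not test functions: they have
    corners, and the first and the last one reach the boundary of the interval.
    They are limits of test functions with uniformly bounded derivatives, built
    from x exp(-1/x), and dominated convergence extends the definition of the weak
    derivative to them ([weak_derivative_tent]). *)

Set Implicit Arguments.
Unset Strict Implicit.
Unset Printing Implicit Defensive.

Import Order.TTheory GRing.Theory Num.Theory.
Import numFieldNormedType.Exports.

Local Open Scope classical_set_scope.
Local Open Scope ring_scope.

(** * Smooth functions and the flat functions x^-m exp(-1/x) *)
Section SmoothFunctions.
Variable R : realType.
Implicit Types (f g : R -> R) (k m : nat) (x c d : R).

(** The derivative is existentially quantified rather than written with the
    derivation operator, so that closure under sums, products and inverses is an
    induction that never rewrites a derivative under a binder. *)
Fixpoint differentiable_times k f : Prop :=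
  if k is k'.+1 then
    exists2 df, forall x, is_derive x 1 f (df x) & differentiable_times k' df
  else True.

Definition smooth f := forall k, differentiable_times k f.

Lemma differentiable_timesW k f :
  differentiable_times k.+1 f -> differentiable_times k f.
Proof.
elim: k f => [//|k IH] f [df fdf kdf]; exists df => //; exact: IH.
Qed.

(** Converts to the form in which test functions are required to be smooth. *)
Lemma smooth_derivable f k x : smooth f -> derivable (f^`(k))%classic x 1.
Proof.
move=> /(_ k.+1); elim: k f => [|k IH] f [df fdf kdf].
  exact: (@ex_derive _ _ _ _ _ _ _ (fdf x)).
rewrite derive1Sn (_ : f^`()%classic = df); first exact: IH.
by apply/funext => y; rewrite derive1E (@derive_val _ _ _ _ _ _ _ (fdf y)).
Qed.

Lemma smooth_cst c : smooth (cst c).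
Proof.
move=> k; elim: k c => [//|k IH] c; exists (cst 0) => // x.
exact: is_derive_cst.
Qed.

Lemma smooth_id : smooth id.
Proof.
case=> [//|k]; exists (cst 1); last exact: smooth_cst.
by move=> x; exact: is_derive_id.
Qed.

Lemma differentiable_timesD k f g :
  differentiable_times k f -> differentiable_times k g ->
  differentiable_times k (fun x => f x + g x).
Proof.
elim: k f g => [//|k IH] f g [df fdf kf] [dg gdg kg].
exists (fun x => df x + dg x); last exact: IH.
by move=> x; apply: (@is_deriveD _ _ _ f g).
Qed.

Lemma differentiable_timesM k f g :
  differentiable_times k f -> differentiable_times k g ->
  differentiable_times k (fun x => f x * g x).
Proof.
elim: k f g => [//|k IH] f g kf kg.
have /differentiable_timesW kf' := kf; have /differentiable_timesW kg' := kg.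
case: kf kg => [df fdf kf] [dg gdg kg].
exists (fun x => f x * dg x + g x * df x).
  by move=> x; apply: (@is_deriveM _ _ f g).
by apply: differentiable_timesD; apply: IH.
Qed.

Lemma differentiable_timesV k f : (forall x, f x != 0) ->
  differentiable_times k f -> differentiable_times k (fun x => (f x)^-1).
Proof.
move=> f0; elim: k => [//|k IH] kf.
have /differentiable_timesW /IH kf' := kf.
case: kf => df fdf kf.
exists (fun x => ((- 1) * df x) * ((f x)^-1 * (f x)^-1)).
  move=> x; have [fx dfx] := fdf x; split; first exact: derivableV.
  rewrite deriveV // dfx /GRing.scale /=; have := f0 x => ?; field; exact: f0.
apply: differentiable_timesM; last exact: differentiable_timesM.
by apply: differentiable_timesM => //; exact: smooth_cst.
Qed.

Lemma is_derive_comp_affine f c d x l :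
  is_derive (c * x + d) 1 f l ->
  is_derive x 1 (fun y => f (c * y + d)) (c * l).
Proof.
move=> fl.
have al : is_derive x 1 (c *: (id : R -> R) + cst d) (c *: (1 : R) + 0).
  exact: is_deriveD.
move: al; rewrite addr0 /GRing.scale /= mulr1 => al.
by rewrite mulrC; exact: (@is_derive1_comp _ f (fun y => c * y + d)).
Qed.

Lemma differentiable_times_comp_affine k f c d :
  differentiable_times k f ->
  differentiable_times k (fun x => f (c * x + d)).
Proof.
elim: k f => [//|k IH] f [df fdf kf].
exists (fun x => c * df (c * x + d)).
  by move=> x; exact: is_derive_comp_affine.
apply: differentiable_timesM; last exact: IH.
exact: smooth_cst.
Qed.

(** All the derivatives of [flat 0] are linear combinations of the functions
    [flat m], and the family is closed under derivation, so that smoothness of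
    the whole family is a single induction. *)
Definition flat m x : R := if 0 < x then x ^- m * expR (- x^-1) else 0.

Lemma flat_gt0 m x : 0 < x -> 0 < flat m x.
Proof. by move=> x0; rewrite /flat x0 mulr_gt0 ?expR_gt0 // invr_gt0 exprn_gt0. Qed.

Lemma flat_le0 m x : x <= 0 -> flat m x = 0.
Proof. by rewrite /flat ltNge => ->. Qed.

Lemma flat_ge0 m x : 0 <= flat m x.
Proof. by case: (ltP 0 x) => x0; [exact/ltW/flat_gt0|rewrite flat_le0]. Qed.

(** The exponential beats every power: [expR s >= s ^ (m+1) / (m+1)!] at
    [s = 1/x].  A bound linear in x, for every m, is what makes the difference
    quotients of [flat m] at 0, which are values of [flat (m+1)], tend to 0. *)
Lemma flat_le m x : flat m x <= m.+1`!%:R * `|x|.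
Proof.
have [x0|x0] := leP x 0; first by rewrite flat_le0 // mulr_ge0.
have f0 : 0 < m.+1`!%:R :> R by rewrite ltr0n fact_gt0.
rewrite /flat x0 expRN gtr0_norm // ler_pdivrMr ?expR_gt0 //.
have s0 : 0 <= x^-1 by rewrite invr_ge0 ltW.
apply: (@le_trans _ _ (m.+1`!%:R * x * (x^-1 ^+ m.+1 / m.+1`!%:R))).
  rewrite exprS -exprVn -subr_ge0 le_eqVlt; apply/orP; left; apply/eqP.
  by field; rewrite !gt_eqF.
rewrite ler_pM2l ?mulr_gt0 //; apply: le_trans (@expR_ge1Dxn _ _ m s0).
by rewrite lerDr ler01.
Qed.

Lemma is_derive_flat m x :
  is_derive x 1 (flat m) (- m%:R * flat m.+1 x + flat m.+2 x).
Proof.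
have [x0|x0|->] := ltgtP x 0.
- apply: (@near_eq_is_derive _ _ _ (cst 0)).
    near=> y; rewrite flat_le0 // ltW //; near: y; exact: lt_nbhsl.
  rewrite !flat_le0 ?ltW // mulr0 addr0; exact: is_derive_cst.
- have xn0 : x != 0 by rewrite gt_eqF.
  have xmn0 : x ^+ m != 0 by rewrite expf_neq0.
  have iv : is_derive x 1 (fun y : R => y^-1) (- x ^- 2).
    split; first exact: derivableV.
    by rewrite deriveV // derive_id /GRing.scale /= mulr1.
  have ex : is_derive x 1 (fun y : R => expR (- y^-1)) (expR (- x^-1) * x ^- 2).
    apply: (@is_derive1_comp _ expR (fun y => - y^-1)).
    rewrite -[_ ^- 2]opprK; exact: is_deriveN.
  have mx : is_derive x 1 (fun y : R => (y ^+ m)^-1)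
      (- (x ^- m) ^+ 2 * (m%:R * x ^+ m.-1)).
    split; first by apply: derivableV => //; exact: exprn_derivable.
    rewrite (@deriveV _ _ (fun y : R => y ^+ m)) //; last exact: exprn_derivable.
    by rewrite exp_derive /GRing.scale /= mulr1 exprVn.
  have h : is_derive x 1 (fun y : R => (y ^+ m)^-1 * expR (- y^-1))
      (x ^- m * (expR (- x^-1) * x ^- 2)
       + expR (- x^-1) * (- (x ^- m) ^+ 2 * (m%:R * x ^+ m.-1))).
    exact: is_deriveM.
  have -> : - m%:R * flat m.+1 x + flat m.+2 x =
       (x ^- m * (expR (- x^-1) * x ^- 2)
       + expR (- x^-1) * (- (x ^- m) ^+ 2 * (m%:R * x ^+ m.-1))).
    rewrite /flat x0; case: m {iv ex mx h} xmn0 => [|m] xmn0 /=.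
      by rewrite !mulr0n; field.
    rewrite !exprS; field; by move: xmn0; rewrite exprS mulf_eq0 negb_or => /andP[_ ->].
  apply: near_eq_is_derive h.
  near=> y; rewrite /flat ifT //; near: y; exact: lt_nbhsr.
- rewrite !flat_le0 // mulr0 addr0.
  have c0 : (fun h : R => m.+2`!%:R * `|h|) @ 0^' --> (0 : R).
    have : (fun h : R => m.+2`!%:R * `|h|) @ 0^' --> (m.+2`!%:R * `|0 : R|).
      apply: cvg_within_filter.
      by apply: cvgM; [exact: cvg_cst|exact: norm_continuous].
    by rewrite normr0 mulr0.
  have l : (fun h : R => h^-1 *: ((flat m \o shift 0) (h *: (1:R)) - flat m 0)) @ 0^' --> (0 : R).
    apply: (@squeeze_cvgr _ _ _ _ (fun h => - (m.+2`!%:R * `|h|)) (fun h => m.+2`!%:R * `|h|)).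
    + near=> h; have h0 : h != 0 by near: h; exact: nbhs_dnbhs_neq.
      rewrite /= -ler_norml (flat_le0 m (lexx 0)) subr0 /GRing.scale /= mulr1 addr0.
      have -> : h^-1 * flat m h = flat m.+1 h.
        have [hn|hp] := leP h 0; first by rewrite !flat_le0 ?mulr0.
        by rewrite /flat hp exprS invfM mulrA.
      by rewrite ger0_norm ?flat_ge0 // flat_le.
    + by have := cvgN c0; rewrite oppr0; apply.
    + exact: c0.
  split; first by apply/cvg_ex; exists 0.
  by rewrite /derive; apply: (cvg_lim _ l); exact: Rhausdorff.
Unshelve. all: by end_near.
Qed.

Lemma smooth_flat m : smooth (flat m).
Proof.
move=> k; elim: k m => [//|k IH] m.
exists (fun x => - m%:R * flat m.+1 x + flat m.+2 x); first exact: is_derive_flat.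
apply: differentiable_timesD => //; apply: differentiable_timesM => //.
exact: smooth_cst.
Qed.

End SmoothFunctions.

(** * A smooth approximation of the unit ramp *)
Section SmoothRamp.
Variable R : realType.
Implicit Types (u x y z j : R) (n : nat).

(** A smooth substitute for the positive part: [x exp(-1/x)] is flat at 0 and
    within 1 of x for x > 0, with derivative in [0, 1].  Rescaling it by a large
    factor therefore recovers the positive part together with its derivative. *)
Definition soft_pos x : R := x * flat 0 x.
Definition dsoft_pos x : R := flat 0 x + flat 1 x.

Lemma is_derive_soft_pos x : is_derive x 1 soft_pos (dsoft_pos x).
Proof.
have h := is_deriveM (is_derive_id x 1) (is_derive_flat 0 x).
apply: (@is_derive_eq _ _ _ _ _ _ _ _ h).
rewrite /dsoft_pos /GRing.scale /= oppr0 mul0r add0r mulr1 addrC; congr (_ + _).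
have [x0|x0] := leP x 0; first by rewrite !flat_le0 // mulr0.
by rewrite /flat x0; field; rewrite gt_eqF.
Qed.

Lemma smooth_soft_pos : smooth soft_pos.
Proof.
by move=> k; apply: differentiable_timesM; [exact: smooth_id|exact: smooth_flat].
Qed.

Lemma soft_pos_le0 x : x <= 0 -> soft_pos x = 0.
Proof. by move=> x0; rewrite /soft_pos flat_le0 // mulr0. Qed.

Lemma soft_pos_gt0 x : 0 < x -> 0 < soft_pos x.
Proof. by move=> x0; rewrite /soft_pos mulr_gt0 // flat_gt0. Qed.

Lemma soft_pos_ge0 x : 0 <= soft_pos x.
Proof. by have [/soft_pos_le0->//|/soft_pos_gt0/ltW] := leP x 0. Qed.

Lemma dsoft_pos_le0 x : x <= 0 -> dsoft_pos x = 0.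
Proof. by move=> x0; rewrite /dsoft_pos !flat_le0 // addr0. Qed.

Lemma dsoft_pos_ge0 x : 0 <= dsoft_pos x.
Proof. by rewrite addr_ge0 // flat_ge0. Qed.

Lemma flat0_le1 x : flat 0 x <= 1.
Proof.
have [x0|x0] := leP x 0; first by rewrite flat_le0.
by rewrite /flat x0 expr0 invr1 mul1r -expR0 ler_expR oppr_le0 invr_ge0 ltW.
Qed.

Lemma flat0_le_dsoft_pos x : flat 0 x <= dsoft_pos x.
Proof. by rewrite lerDl flat_ge0. Qed.

(** At [s = 1/x] this is [(1 + s) exp(-s) <= 1]. *)
Lemma dsoft_pos_le1 x : dsoft_pos x <= 1.
Proof.
have [x0|x0] := leP x 0; first by rewrite dsoft_pos_le0.
rewrite /dsoft_pos /flat x0 expr0 expr1 invr1 -mulrDl expRN.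
by rewrite ler_pdivrMr ?expR_gt0 // mul1r expR_ge1Dx.
Qed.

Lemma soft_pos_ler x : 0 <= x -> soft_pos x <= x.
Proof. by move=> x0; rewrite /soft_pos ler_piMr // flat0_le1. Qed.

Lemma soft_pos_ge x : x - 1 <= soft_pos x.
Proof.
have [x0|x0] := leP x 0.
  by rewrite soft_pos_le0 // subr_le0 (le_trans x0).
rewrite /soft_pos /flat x0 expr0 invr1 mul1r.
apply: (@le_trans _ _ (x * (1 - x^-1))); last by rewrite ler_pM2l // expR_ge1Dx.
by rewrite mulrBr mulr1 mulfV ?gt_eqF.
Qed.

(** The usual quotient p/(p+q) of a smooth step, with p and q proportional, up
    to O(1/j), to u and 1-u; hence it tends to u itself on [0, 1] as j grows.
    The shifts by -1 keep it locally constant near 0 and 1, so that differences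
    of such ramps have compact support inside the tent that they approximate. *)
Definition sramp j u : R :=
  soft_pos (j * u - 1) / (soft_pos (j * u - 1) + soft_pos (j * (1 - u) - 1)).

Definition dsramp j u : R :=
  j * (dsoft_pos (j * u - 1) * soft_pos (j * (1 - u) - 1)
       + soft_pos (j * u - 1) * dsoft_pos (j * (1 - u) - 1))
  / (soft_pos (j * u - 1) + soft_pos (j * (1 - u) - 1)) ^+ 2.

Definition sramp_den j u := soft_pos (j * u - 1) + soft_pos (j * (1 - u) - 1).

(** The two arguments of [soft_pos] add up to j - 2, and each value loses at
    most 1. *)
Lemma sramp_den_ge j u : j - 4 <= sramp_den j u.
Proof.
have := soft_pos_ge (j * u - 1); have := soft_pos_ge (j * (1 - u) - 1).
rewrite /sramp_den; lra.
Qed.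

Lemma sramp_den_gt0 j u : 8 <= j -> 0 < sramp_den j u.
Proof. by move=> j8; apply: lt_le_trans (sramp_den_ge j u); lra. Qed.

Lemma is_derive_soft_pos_affine j d u :
  is_derive u 1 (fun v => soft_pos (j * v + d)) (j * dsoft_pos (j * u + d)).
Proof. exact: is_derive_comp_affine (is_derive_soft_pos _). Qed.

Lemma is_derive_sramp j u : 8 <= j -> is_derive u 1 (sramp j) (dsramp j u).
Proof.
move=> j8.
(* the second argument in the affine form that the chain rule expects *)
have E1 v : j * (1 - v) - 1 = - j * v + (j - 1) by ring.
have h1 := is_derive_soft_pos_affine j (- 1) u.
have h2 := is_derive_soft_pos_affine (- j) (j - 1) u.
have D0 : soft_pos (j * u + -1) + soft_pos (- j * u + (j - 1)) != 0.
  by rewrite -E1 gt_eqF // sramp_den_gt0.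
have h3 := is_deriveD h1 h2.
have h4 : is_derive u 1 (fun v => (soft_pos (j * v - 1) + soft_pos (- j * v + (j - 1)))^-1)
  (- (soft_pos (j * u - 1) + soft_pos (- j * u + (j - 1))) ^- 2 *
   (j * dsoft_pos (j * u - 1) + - j * dsoft_pos (- j * u + (j - 1)))).
  case: h3 => d3 e3; split; first exact: derivableV.
  by rewrite deriveV // e3.
have h5 := is_deriveM h1 h4.
have -> : sramp j = (fun v => soft_pos (j * v + -1)) *
  (fun v => (soft_pos (j * v - 1) + soft_pos (- j * v + (j - 1)))^-1).
  by apply/funext => v; rewrite /sramp E1.
apply: (@is_derive_eq _ _ _ _ _ _ _ _ h5).
rewrite /dsramp E1 /GRing.scale /=; field; exact: D0.
Qed.

Lemma smooth_sramp j : 8 <= j -> smooth (sramp j).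
Proof.
move=> j8 k.
have s1 : differentiable_times k (fun u => soft_pos (j * u - 1)).
  by apply: differentiable_times_comp_affine; exact: smooth_soft_pos.
have s2 : differentiable_times k (fun u => soft_pos (j * (1 - u) - 1)).
  rewrite (_ : (fun u => _) = fun u => soft_pos (- j * u + (j - 1))).
    by apply: differentiable_times_comp_affine; exact: smooth_soft_pos.
  by apply/funext => u; congr soft_pos; ring.
apply: differentiable_timesM => //; apply: differentiable_timesV.
  by move=> u; rewrite gt_eqF // sramp_den_gt0.
exact: differentiable_timesD.
Qed.

Lemma sramp_eq0 j u : j * u <= 1 -> sramp j u = 0.
Proof. by move=> u0; rewrite /sramp (@soft_pos_le0 (j * u - 1)) ?mul0r // subr_le0. Qed.

Lemma sramp_eq1 j u : 8 <= j -> j * (1 - u) <= 1 -> sramp j u = 1.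
Proof.
move=> j8 u1; have := sramp_den_gt0 u j8.
rewrite /sramp /sramp_den (@soft_pos_le0 (j * (1 - u) - 1)) ?subr_le0 // addr0.
by move=> ?; rewrite divff // gt_eqF.
Qed.

Lemma sramp_ge0 j u : 0 <= sramp j u.
Proof. by rewrite divr_ge0 ?addr_ge0 ?soft_pos_ge0. Qed.

Lemma sramp_le1 j u : 8 <= j -> sramp j u <= 1.
Proof.
move=> j8; rewrite ler_pdivrMr ?(sramp_den_gt0 u j8) // mul1r lerDl.
exact: soft_pos_ge0.
Qed.

Lemma dsramp_ge0 j u : 8 <= j -> 0 <= dsramp j u.
Proof.
move=> j8; rewrite divr_ge0 ?sqr_ge0 // mulr_ge0 ?(le_trans _ j8) //.
by rewrite addr_ge0 // mulr_ge0 ?soft_pos_ge0 ?dsoft_pos_ge0.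
Qed.

(** By [soft_pos' <= 1] the numerator is at most j(p + q), so the derivative is
    at most j/(p + q) <= j/(j - 4). *)
Lemma dsramp_le2 j u : 8 <= j -> dsramp j u <= 2.
Proof.
move=> j8; have D0 := sramp_den_gt0 u j8; have Dj := sramp_den_ge j u.
rewrite /dsramp ler_pdivrMr ?exprn_gt0 //.
apply: (@le_trans _ _ (j * sramp_den j u)).
  rewrite ler_pM2l ?(lt_le_trans _ j8) // addrC.
  by rewrite lerD // ?ler_piMr ?ler_piMl ?soft_pos_ge0 // dsoft_pos_le1.
rewrite -/(sramp_den j u) expr2 mulrA ler_pM2r //; lra.
Qed.

Lemma dsramp_eq0l j u : j * u <= 1 -> dsramp j u = 0.
Proof.
move=> u0; rewrite /dsramp (@soft_pos_le0 (j * u - 1)) ?(@dsoft_pos_le0 (j * u - 1)) ?subr_le0 //.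
by rewrite !mul0r addr0 mulr0 mul0r.
Qed.

Lemma dsramp_eq0r j u : j * (1 - u) <= 1 -> dsramp j u = 0.
Proof.
move=> u0; rewrite /dsramp (@soft_pos_le0 (j * (1 - u) - 1)) ?subr_le0 //.
by rewrite (@dsoft_pos_le0 (j * (1 - u) - 1)) ?subr_le0 // !mulr0 addr0 mulr0 mul0r.
Qed.

(** The shift by 8 makes the denominators of [sramp] positive and the bound 2
    on its derivative valid for every index, not only eventually. *)
Definition sharpness n : R := (n + 8)%:R.

Lemma sharpness_ge8 n : 8 <= sharpness n.
Proof. by rewrite /sharpness ler_nat leq_addl. Qed.

Lemma cvg_sharpnessV : (sharpness n)^-1 @[n --> \oo] --> (0 : R).
Proof.
have := @cvg_harmonic R; rewrite -(cvg_shiftn 7); apply: cvg_trans.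
by apply: near_eq_cvg; near=> n; rewrite /sharpness /harmonic /= -addnS.
Unshelve. all: by end_near. Qed.

Lemma cvg_soft_pos u : 0 <= u ->
  soft_pos (sharpness n * u - 1) / sharpness n @[n --> \oo] --> u.
Proof.
move=> u0.
have l c : u - c * (sharpness n)^-1 @[n --> \oo] --> u.
  rewrite -[X in _ --> X](subr0 u) -[X in u - X](mulr0 c).
  by apply: cvgB; [exact: cvg_cst|apply: cvgM; [exact: cvg_cst|exact: cvg_sharpnessV]].
apply: (squeeze_cvgr _ (l 2) (l 0)); near=> n.
have s8 := sharpness_ge8 n; have s0 : 0 < sharpness n by lra.
rewrite ler_pdivlMr // mulrBl -mulrA mulVf ?gt_eqF // mulr1.
rewrite ler_pdivrMr // mulrBl -mulrA mulVf ?gt_eqF // mul0r subr0.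
have := soft_pos_ge (sharpness n * u - 1) => h.
apply/andP; split; first lra.
have su : 0 <= sharpness n * u by rewrite mulr_ge0 // ltW.
have [y0|y0] := leP (sharpness n * u - 1) 0; first by rewrite soft_pos_le0; lra.
have := soft_pos_ler (ltW y0); lra.
Unshelve. all: by end_near. Qed.

Lemma cvg_dsoft_pos u : 0 < u ->
  dsoft_pos (sharpness n * u - 1) @[n --> \oo] --> (1 : R).
Proof.
move=> u0.
have l : (soft_pos (sharpness n * u - 1) / sharpness n) / (u - (sharpness n)^-1) @[n --> \oo] --> (1 : R).
  rewrite -[X in _ --> X](@divff _ u) ?gt_eqF //.
  apply: cvgM; first exact: cvg_soft_pos (ltW u0).
  apply: cvgV; first by rewrite gt_eqF.
  rewrite -[X in _ --> X](subr0 u).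
  by apply: cvgB; [exact: cvg_cst|exact: cvg_sharpnessV].
apply: (squeeze_cvgr _ l (cvg_cst (1 : R))); near=> n.
rewrite dsoft_pos_le1 andbT; apply: le_trans (flat0_le_dsoft_pos _).
have s8 := sharpness_ge8 n; have s0 : sharpness n != 0 by rewrite gt_eqF //; lra.
have y0 : 0 < u - (sharpness n)^-1.
  near: n; have : (u - (sharpness n)^-1) @[n --> \oo] --> u.
    rewrite -[X in _ --> X](subr0 u).
    by apply: cvgB; [exact: cvg_cst|exact: cvg_sharpnessV].
  by move/cvgr_gt; apply.
rewrite le_eqVlt; apply/orP; left; apply/eqP.
move: (sharpness n) s0 y0 => s s0 y0; rewrite /soft_pos; field; rewrite s0 /=.
have -> : u * s - 1 = (u - s^-1) * s by field.
by rewrite mulf_neq0 // gt_eqF.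
Unshelve. all: by end_near. Qed.

Definition pos_part u : R := Num.max u 0.

(** Written as a difference of positive parts, the ramp has an explicit
    antiderivative, a combination of squares of positive parts. *)
Definition ramp u : R := pos_part u - pos_part (u - 1).

Lemma pos_partE u : 0 <= u -> pos_part u = u.
Proof. by move=> u0; rewrite /pos_part max_l. Qed.

Lemma pos_part_le0 u : u <= 0 -> pos_part u = 0.
Proof. by move=> u0; rewrite /pos_part max_r. Qed.

Lemma rampE u : 0 <= u <= 1 -> ramp u = u.
Proof.
by case/andP=> u0 u1; rewrite /ramp pos_partE // pos_part_le0 ?subr0 // subr_le0.
Qed.

Lemma ramp_le0 u : u <= 0 -> ramp u = 0.
Proof. by move=> u0; rewrite /ramp !pos_part_le0 ?subr0 // subr_le0 (le_trans u0). Qed.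

Lemma ramp_ge1 u : 1 <= u -> ramp u = 1.
Proof.
by move=> u1; rewrite /ramp !pos_partE ?subr_ge0 ?(le_trans _ u1) // subKr.
Qed.

Lemma ramp_ge0 u : 0 <= ramp u.
Proof.
have [u0|u0] := leP u 0; first by rewrite ramp_le0.
have [u1|u1] := leP 1 u; first by rewrite ramp_ge1.
by rewrite rampE ?(ltW u0) ?(ltW u1).
Qed.

Lemma ramp_le1 u : ramp u <= 1.
Proof.
have [u0|u0] := leP u 0; first by rewrite ramp_le0.
have [u1|u1] := leP 1 u; first by rewrite ramp_ge1.
by rewrite rampE ?(ltW u0) ?(ltW u1).
Qed.

Lemma ramp_homo x y : x <= y -> ramp x <= ramp y.
Proof.
move=> xy.
have [x0|x0] := leP x 0; first by rewrite (ramp_le0 x0) ramp_ge0.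
have [y1|y1] := leP 1 y; first by rewrite (ramp_ge1 y1) ramp_le1.
by rewrite !rampE ?xy //; apply/andP; split; lra.
Qed.

Lemma continuous_pos_part : continuous pos_part.
Proof.
have -> : pos_part = (fun u => (u + `|u|) / 2).
  by apply/funext => u; rewrite /pos_part maxr_absE addr0 subr0.
move=> u; apply: (@cvgM _ _ (nbhs u) _ _ (fun _ => 2^-1)); last exact: cvg_cst.
by apply: cvgD; [exact: cvg_id|exact: norm_continuous].
Qed.

Lemma is_derive_sqr_pos_part u :
  is_derive u 1 (fun v => pos_part v ^+ 2 / 2) (pos_part u).
Proof.
have [u0|u0|->] := ltgtP u 0.
- apply: (@near_eq_is_derive _ _ _ (cst 0)).
    near=> y; rewrite pos_part_le0 ?expr0n ?mul0r // ltW //; near: y; exact: lt_nbhsl.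
  by rewrite pos_part_le0 ?ltW //; exact: is_derive_cst.
- have h : is_derive u 1 (fun v : R => v ^+ 2 / 2) u.
    have h := is_deriveM (is_derive_id u 1) (is_deriveZ 2^-1 (is_derive_id u 1)).
    rewrite (_ : (fun v => _) = (id : R -> R) * (2^-1 *: (id : R -> R))).
      apply: (@is_derive_eq _ _ _ _ _ _ _ _ h); rewrite /GRing.scale /= /GRing.scale /=; lra.
    by apply/funext => v; rewrite expr2 -mulrA [v / 2]mulrC.
  rewrite pos_partE ?ltW //; apply: near_eq_is_derive h.
  near=> y; rewrite pos_partE // ltW //; near: y; exact: lt_nbhsr.
- rewrite pos_part_le0 //.
  have c0 : (fun h : R => pos_part h / 2) @ 0^' --> (0 : R).
    have : (fun h : R => pos_part h / 2) @ 0^' --> pos_part 0 / 2.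
      apply: cvg_within_filter.
      by apply: cvgM; [exact: continuous_pos_part|exact: cvg_cst].
    by rewrite pos_part_le0 // mul0r.
  have l : (fun h : R => h^-1 *: (((fun v => pos_part v ^+ 2 / 2) \o shift 0) (h *: (1:R))
       - pos_part 0 ^+ 2 / 2)) @ 0^' --> (0 : R).
    apply: cvg_trans c0; apply: near_eq_cvg; near=> h.
    have h0 : h != 0 by near: h; exact: nbhs_dnbhs_neq.
    rewrite /= (pos_part_le0 (lexx 0)) expr0n /= mul0r subr0 /GRing.scale /= mulr1 addr0.
    have [hn|hp] := leP h 0; first by rewrite pos_part_le0 // expr0n /= !mul0r mulr0.
    by rewrite pos_partE ?ltW //; field.
  split; first by apply/cvg_ex; exists 0.
  by rewrite /derive; apply: (cvg_lim _ l); exact: Rhausdorff.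
Unshelve. all: by end_near. Qed.

Lemma cvg_sramp u : sramp (sharpness n) u @[n --> \oo] --> ramp u.
Proof.
have [u0|u0] := leP u 0.
  rewrite ramp_le0 //; apply: cvg_near_cst; near=> n.
  rewrite sramp_eq0 //; apply: (@le_trans _ _ 0) => //.
  by rewrite pmulr_rle0 // (lt_le_trans _ (sharpness_ge8 n)).
have [u1|u1] := leP 1 u.
  rewrite ramp_ge1 //; apply: cvg_near_cst; near=> n.
  rewrite sramp_eq1 ?sharpness_ge8 //; apply: (@le_trans _ _ 0) => //.
  by rewrite pmulr_rle0 ?subr_le0 // (lt_le_trans _ (sharpness_ge8 n)).
rewrite rampE ?ltW //.
have l1 := cvg_soft_pos (ltW u0).
have l2 : soft_pos (sharpness n * (1 - u) - 1) / sharpness n @[n --> \oo] --> 1 - u.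
  by apply: cvg_soft_pos; lra.
have l : (soft_pos (sharpness n * u - 1) / sharpness n) /
   (soft_pos (sharpness n * u - 1) / sharpness n + soft_pos (sharpness n * (1 - u) - 1) / sharpness n)
   @[n --> \oo] --> u / (u + (1 - u)).
  by apply: cvgM => //; apply: cvgV; [rewrite gt_eqF; lra|exact: cvgD].
move: l; rewrite (addrC u) subrK divr1; apply: cvg_trans; apply: near_eq_cvg.
near=> n; have s8 := sharpness_ge8 n.
have D0 := sramp_den_gt0 u s8.
rewrite /sramp -mulrDl invfM invrK mulrACA mulVf ?mulr1 // gt_eqF //; lra.
Unshelve. all: by end_near. Qed.

(** The limit holds at every point, the two corners included: there the
    derivative of the approximation is identically 0. *)
Lemma cvg_dsramp u :
  dsramp (sharpness n) u @[n --> \oo] --> (\1_(`]0, 1[%classic) u : R).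
Proof.
have [u0|u0] := leP u 0.
  rewrite indicE memNset; last by rewrite /= in_itv /= ltNge u0.
  apply: cvg_near_cst; near=> n.
  rewrite dsramp_eq0l //; apply: (@le_trans _ _ 0) => //.
  by rewrite pmulr_rle0 // (lt_le_trans _ (sharpness_ge8 n)).
have [u1|u1] := leP 1 u.
  rewrite indicE memNset; last by rewrite /= in_itv /= [u < 1]ltNge u1 andbF.
  apply: cvg_near_cst; near=> n.
  rewrite dsramp_eq0r //; apply: (@le_trans _ _ 0) => //.
  by rewrite pmulr_rle0 ?subr_le0 // (lt_le_trans _ (sharpness_ge8 n)).
rewrite indicE mem_set /=; last by rewrite in_itv /= u0.
have u1' : 0 < 1 - u by lra.
have l1 := cvg_soft_pos (ltW u0).
have l2 := cvg_soft_pos (ltW u1').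
have l3 := cvg_dsoft_pos u0.
have l4 := cvg_dsoft_pos u1'.
have l5 : (soft_pos (sharpness n * u - 1) / sharpness n
   + soft_pos (sharpness n * (1 - u) - 1) / sharpness n) @[n --> \oo] --> u + (1 - u).
  exact: cvgD.
rewrite (addrC u) subrK in l5.
have l : (dsoft_pos (sharpness n * u - 1) * (soft_pos (sharpness n * (1 - u) - 1) / sharpness n)
   + (soft_pos (sharpness n * u - 1) / sharpness n) * dsoft_pos (sharpness n * (1 - u) - 1))
   / ((soft_pos (sharpness n * u - 1) / sharpness n
       + soft_pos (sharpness n * (1 - u) - 1) / sharpness n)
     * (soft_pos (sharpness n * u - 1) / sharpness n
       + soft_pos (sharpness n * (1 - u) - 1) / sharpness n))
   @[n --> \oo] --> (1 * (1 - u) + u * 1) / (1 * 1).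
  apply: cvgM; first by apply: cvgD; exact: cvgM.
  by apply: cvgV; [rewrite mulr1 oner_eq0|exact: cvgM].
move: l; rewrite mul1r !mulr1 subrK divr1; apply: cvg_trans; apply: near_eq_cvg.
near=> n; have s8 := sharpness_ge8 n.
have := sramp_den_gt0 u s8; rewrite /sramp_den /dsramp.
have : sharpness n != 0 by rewrite gt_eqF //; lra.
move: (sharpness n) => s s0 D0; field; rewrite s0 gt_eqF //.
Unshelve. all: by end_near. Qed.

End SmoothRamp.

(** * Integration of real-valued functions against bounded multipliers *)
Section RealIntegrable.
Context d (T : measurableType d) (R : realType).
Variables (mu : {measure set T -> \bar R}) (D : set T) (mD : measurable D).

Lemma integrable_funZ (r : R) (h : T -> R) : mu.-integrable D (EFin \o h) ->
  mu.-integrable D (EFin \o (fun x => r * h x)).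
Proof.
move=> ih; rewrite (_ : _ \o _ = fun x => (r%:E * (EFin \o h) x)%E) //.
exact: integrableZl.
Qed.

Lemma integrable_funB (h1 h2 : T -> R) :
  mu.-integrable D (EFin \o h1) -> mu.-integrable D (EFin \o h2) ->
  mu.-integrable D (EFin \o (fun x => h1 x - h2 x)).
Proof.
move=> ih1 ih2; rewrite (_ : _ \o _ = ((EFin \o h1) \- (EFin \o h2))%E) //.
exact: integrableB.
Qed.

Lemma integrable_bounded_mul (g h : T -> R) (K : R) :
  mu.-integrable D (EFin \o g) -> measurable_fun D h ->
  (forall x, `|h x| <= K) ->
  mu.-integrable D (EFin \o (fun x => g x * h x)).
Proof.
move=> ig mh hK; have mg : measurable_fun D g.
  by apply/measurable_EFinP; exact: measurable_int ig.
apply: (@le_integrable _ _ _ _ _ mD _ (EFin \o (fun x => g x * K))).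
- by apply/measurable_EFinP; exact: measurable_funM.
- move=> x Dx; rewrite /= lee_fin !normrM ler_wpM2l //.
  by rewrite (le_trans (hK x)) // ler_norm.
- rewrite (_ : _ \o _ = fun x => (K%:E * (g x)%:E)%E); first exact: integrableZl.
  by apply/funext => x; rewrite /= mulrC EFinM.
Qed.

Lemma cvg_Rintegral_bounded_mul (g : T -> R) (h_ : nat -> T -> R) (h : T -> R)
    (K : R) :
  mu.-integrable D (EFin \o g) -> (forall n, measurable_fun D (h_ n)) ->
  measurable_fun D h -> (forall n x, `|h_ n x| <= K) ->
  (forall x, h_ n x @[n --> \oo] --> h x) ->
  \int[mu]_(x in D) (g x * h_ n x) @[n --> \oo] -->
    \int[mu]_(x in D) (g x * h x).
Proof.
move=> ig mh_ mh hK hh; have mg : measurable_fun D g.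
  by apply/measurable_EFinP; exact: measurable_int ig.
have iK : mu.-integrable D (fun x => (`|g x| * K)%:E).
  rewrite (_ : (fun x => _) = fun x => (K%:E * (abse \o (EFin \o g)) x)%E).
    by apply: integrableZl => //; exact: integrable_abse.
  by apply/funext => x; rewrite /= mulrC EFinM.
have [] := @dominated_convergence _ _ _ mu D mD
  (fun n x => (g x * h_ n x)%:E) (fun x => (g x * h x)%:E)
  (fun x => (`|g x| * K)%:E) => //.
- by move=> n; apply/measurable_EFinP; exact: measurable_funM.
- by apply/measurable_EFinP; exact: measurable_funM.
- apply: aeW => x Dx; apply: cvg_EFin; first exact: nearW.
  by apply: cvgM => //; exact: cvg_cst.
- by apply: aeW => x n Dx; rewrite lee_fin normrM ler_wpM2l.
move=> if_ _ l; apply: fine_cvg; rewrite fineK //.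
exact: integrable_fin_num.
Qed.

End RealIntegrable.

(** * Tents as limits of test functions *)
Section Tents.
Variable R : realType.
Implicit Types (c d x : R) (n k : nat).
Notation mu := (@lebesgue_measure R).

(** Supported where 0 <= c x + d <= 2; written as a difference of two
    consecutive ramps so that sums of consecutive tents telescope. *)
Definition tent c d x : R := ramp (c * x + d) - ramp (c * x + (d - 1)).

Definition dtent c d x : R :=
  c * (\1_(`]0, 1[%classic : set R) (c * x + d)
       - \1_(`]0, 1[%classic : set R) (c * x + (d - 1))).

Definition smooth_tent n c d x : R :=
  sramp (sharpness R n) (c * x + d) - sramp (sharpness R n) (c * x + (d - 1)).

Definition dsmooth_tent n c d x : R :=
  c * (dsramp (sharpness R n) (c * x + d) - dsramp (sharpness R n) (c * x + (d - 1))).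

Lemma is_derive_smooth_tent n c d x :
  is_derive x 1 (smooth_tent n c d) (dsmooth_tent n c d x).
Proof.
rewrite /dsmooth_tent mulrBr.
have h e : is_derive x 1 (fun y => sramp (sharpness R n) (c * y + e))
   (c * dsramp (sharpness R n) (c * x + e)).
  exact: is_derive_comp_affine (is_derive_sramp _ (sharpness_ge8 _ _)).
exact: is_deriveB (h d) (h (d - 1)).
Qed.

Lemma smooth_smooth_tent n c d : smooth (smooth_tent n c d).
Proof.
move=> k; have s e : differentiable_times k (fun y => sramp (sharpness R n) (c * y + e)).
  by apply: differentiable_times_comp_affine; apply: smooth_sramp; exact: sharpness_ge8.
have -> : smooth_tent n c d = (fun x => sramp (sharpness R n) (c * x + d) +
    (-1) * sramp (sharpness R n) (c * x + (d - 1))).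
  by apply/funext => x; rewrite mulN1r.
apply: differentiable_timesD => //; apply: differentiable_timesM => //.
exact: smooth_cst.
Qed.

Lemma derive1_smooth_tent n c d :
  (smooth_tent n c d)^`()%classic = dsmooth_tent n c d.
Proof.
apply/funext => x; rewrite derive1E.
exact: (@derive_val _ _ _ _ _ _ _ (is_derive_smooth_tent n c d x)).
Qed.

Lemma smooth_derivable1 (f : R -> R) x : smooth f -> derivable f x 1.
Proof. by move=> /(@smooth_derivable _ _ 0 x). Qed.

Lemma smooth_continuous (f : R -> R) : smooth f -> continuous f.
Proof.
move=> sf x; apply: differentiable_continuous.
by apply/derivable1_diffP; exact: smooth_derivable1.
Qed.

Lemma measurable_smooth_tent n c d : measurable_fun setT (smooth_tent n c d).
Proof.
by apply: continuous_measurable_fun; apply: smooth_continuous; exact: smooth_smooth_tent.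
Qed.

Lemma measurable_dsmooth_tent n c d : measurable_fun setT (dsmooth_tent n c d).
Proof.
apply: continuous_measurable_fun => x; rewrite -derive1_smooth_tent.
apply: differentiable_continuous; apply/derivable1_diffP.
rewrite -derive1n1; exact: smooth_derivable (@smooth_smooth_tent n c d).
Qed.

Lemma measurable_affine c d : measurable_fun [set: R] (fun x : R => c * x + d).
Proof. by apply: measurable_funD => //; exact: measurable_funM. Qed.

Lemma continuous_affine c d : continuous (fun x : R => c * x + d).
Proof.
move=> x; apply: (@cvgD _ _ _ (nbhs x) _ (fun x => c * x) (fun=> d)); last exact: cvg_cst.
by apply: cvgM; [exact: cvg_cst|exact: cvg_id].
Qed.

Lemma continuous_ramp : continuous (@ramp R).
Proof.
move=> x; apply: (@cvgB _ _ _ (nbhs x) _ (@pos_part R) (fun u => pos_part (u - 1))).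
  exact: continuous_pos_part.
apply: (@continuous_comp _ _ _ (fun u : R => u - 1) (@pos_part R)).
  by apply: (@cvgB _ _ _ (nbhs x) _ id (fun=> 1)); [exact: cvg_id|exact: cvg_cst].
exact: continuous_pos_part.
Qed.

Lemma continuous_tent c d : continuous (tent c d).
Proof.
have h e : continuous (fun x => ramp (c * x + e)).
  move=> x; apply: (@continuous_comp _ _ _ (fun x : R => c * x + e) (@ramp R)).
    exact: continuous_affine.
  exact: continuous_ramp.
move=> x.
by apply: (@cvgB _ _ _ (nbhs x) _ (fun x => ramp (c * x + d))
  (fun x => ramp (c * x + (d - 1)))); exact: h.
Qed.

Lemma measurable_tent c d : measurable_fun setT (tent c d).
Proof. by apply: continuous_measurable_fun; exact: continuous_tent. Qed.

Lemma measurable_dtent c d : measurable_fun setT (dtent c d).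
Proof.
apply: measurable_funM => //.
have m e : measurable_fun setT (fun x => \1_(`]0, 1[%classic : set R) (c * x + e) : R).
  apply: measurableT_comp (measurable_affine c e).
  exact: measurable_indic.
exact: measurable_funB.
Qed.

Lemma cvg_smooth_tent c d x : smooth_tent n c d x @[n --> \oo] --> tent c d x.
Proof. by apply: cvgB; exact: cvg_sramp. Qed.

Lemma cvg_dsmooth_tent c d x : dsmooth_tent n c d x @[n --> \oo] --> dtent c d x.
Proof.
by apply: cvgM; [exact: cvg_cst|apply: cvgB; exact: cvg_dsramp].
Qed.

Lemma smooth_tent_bound n c d x : `|smooth_tent n c d x| <= 1.
Proof.
have s8 := sharpness_ge8 R n; rewrite ler_norml /smooth_tent.
have := sramp_ge0 (sharpness R n) (c * x + d).
have := sramp_ge0 (sharpness R n) (c * x + (d - 1)).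
have := sramp_le1 (c * x + d) s8.
have := sramp_le1 (c * x + (d - 1)) s8.
by move=> *; apply/andP; split; lra.
Qed.

Lemma dsmooth_tent_bound n c d x : `|dsmooth_tent n c d x| <= `|c| * 2.
Proof.
have s8 := sharpness_ge8 R n; rewrite normrM ler_wpM2l // ler_norml.
have := dsramp_ge0 (c * x + d) s8.
have := dsramp_ge0 (c * x + (d - 1)) s8.
have := dsramp_le2 (c * x + d) s8.
have := dsramp_le2 (c * x + (d - 1)) s8.
by move=> *; apply/andP; split; lra.
Qed.

(** The conditions on c and d say that the support of the tent is contained in
    the closed unit interval; it may touch the boundary, but the support of the smooth tent is
    smaller by 1/(c s) at both ends, where s is the sharpness. *)
Lemma test_function_smooth_tent n c d : 0 < c -> d <= 0 -> 2 <= c + d ->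
  test_function `]0, 1[%classic (smooth_tent n c d).
Proof.
move=> c0 d0 cd2; set s := sharpness R n; have s8 : 8 <= s := sharpness_ge8 R n.
have s0 : 0 < s by lra.
have si0 : 0 < s^-1 by rewrite invr_gt0.
pose l := (s^-1 - d) / c; pose r := (2 - s^-1 - d) / c.
have sub : [set x | smooth_tent n c d x != 0] `<=` `[l, r]%classic.
  move=> x /= nz; rewrite in_itv /= ler_pdivrMr // ler_pdivlMr //.
  apply/andP; split; rewrite leNgt; apply/negP => h; move/eqP: nz; apply.
    rewrite /smooth_tent -/s !sramp_eq0 ?subr0 // -ler_pdivlMl // mulr1; lra.
  rewrite /smooth_tent -/s !sramp_eq1 ?subrr // -ler_pdivlMl // mulr1; lra.
have csub : closure [set x | smooth_tent n c d x != 0] `<=` `[l, r]%classic.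
  rewrite [X in _ `<=` X](closure_id _).1; first exact: closureS.
  exact: itv_closed.
split.
- by move=> k x; apply: smooth_derivable; exact: smooth_smooth_tent.
- apply: subclosed_compact csub; first exact: closed_closure.
  exact: segment_compact.
- apply: subset_trans csub _ => x /=; rewrite !in_itv /= => /andP[lx xr].
  apply/andP; split.
    by apply: lt_le_trans lx; rewrite divr_gt0 //; lra.
  by apply: le_lt_trans xr _; rewrite ltr_pdivrMr //; lra.
Qed.

Notation D := (`]0%R, 1%R[%classic : set R).

(** Smooth tents and their derivatives are uniformly bounded and converge
    everywhere, so dominated convergence passes to the limit on both sides of
    the identity that defines the weak derivative. *)
Lemma weak_derivative_tent (f f' : R -> R) c d :
  mu.-integrable D (EFin \o f) -> mu.-integrable D (EFin \o f') ->
  weak_derivative D f f' ->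
  0 < c -> d <= 0 -> 2 <= c + d ->
  \int[mu]_(x in D) (f x * dtent c d x) = - \int[mu]_(x in D) (f' x * tent c d x).
Proof.
move=> if_ if' wd c0 d0 cd2.
have l1 : \int[mu]_(x in D) (f x * dsmooth_tent n c d x) @[n --> \oo] -->
    \int[mu]_(x in D) (f x * dtent c d x).
  apply: (@cvg_Rintegral_bounded_mul _ _ _ _ _ _ _ _ _ (`|c| * 2)) => //.
  - by move=> n; apply: measurable_funTS; exact: measurable_dsmooth_tent.
  - by apply: measurable_funTS; exact: measurable_dtent.
  - by move=> n x; exact: dsmooth_tent_bound.
  - by move=> x; exact: cvg_dsmooth_tent.
have l2 : \int[mu]_(x in D) (f' x * smooth_tent n c d x) @[n --> \oo] -->
    \int[mu]_(x in D) (f' x * tent c d x).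
  apply: (@cvg_Rintegral_bounded_mul _ _ _ _ _ _ _ _ _ 1) => //.
  - by move=> n; apply: measurable_funTS; exact: measurable_smooth_tent.
  - by apply: measurable_funTS; exact: measurable_tent.
  - by move=> n x; exact: smooth_tent_bound.
  - by move=> x; exact: cvg_smooth_tent.
have E n : \int[mu]_(x in D) (f x * dsmooth_tent n c d x) =
   - \int[mu]_(x in D) (f' x * smooth_tent n c d x).
  rewrite -derive1_smooth_tent; apply: wd; exact: test_function_smooth_tent.
have l3 : \int[mu]_(x in D) (f x * dsmooth_tent n c d x) @[n --> \oo] -->
    - \int[mu]_(x in D) (f' x * tent c d x).
  apply: cvg_trans (cvgN l2); apply: near_eq_cvg; apply: nearW => n.
  by rewrite E.
exact: (cvg_unique _ l1 l3).
Qed.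

Lemma tent_ge0 c d x : 0 <= tent c d x.
Proof. by rewrite subr_ge0 ramp_homo // lerD2l gerBl. Qed.

Lemma tent_le1 c d x : tent c d x <= 1.
Proof.
have := ramp_ge0 (c * x + (d - 1)); have := ramp_le1 (c * x + d).
rewrite /tent; lra.
Qed.

Lemma sum_tent_le1 c m x : \sum_(0 <= k < m) tent c (- k%:R) x <= 1.
Proof.
rewrite (eq_bigr (fun k : nat => - ramp (c * x - k.+1%:R) - - ramp (c * x - k%:R))).
  rewrite telescope_sumr // opprK.
  have := ramp_ge0 (c * x - m%:R); have := ramp_le1 (c * x - 0%:R); lra.
by move=> k _; rewrite /tent opprK addrC -opprD -natr1 [k%:R + 1]addrC.
Qed.

(** The fundamental theorem of calculus with the antiderivative
    (P(u) - 2 P(u - 1) + P(u - 2)) / c, u = c x + d, where P is half the square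
    of the positive part; the second difference of P is 1 for u >= 2. *)
Lemma Rintegral_tent c d : 0 < c -> d <= 0 -> 2 <= c + d ->
  \int[mu]_(x in D) tent c d x = c^-1.
Proof.
move=> c0 d0 cd2.
pose P (v : R) := pos_part v ^+ 2 / 2.
have hP e x : is_derive x 1 (fun y => P (c * y + e)) (c * pos_part (c * x + e)).
  exact: is_derive_comp_affine (is_derive_sqr_pos_part _).
pose Q := c^-1 *: ((fun y => P (c * y + d)) -
  2 *: (fun y => P (c * y + (d - 1))) + (fun y => P (c * y + (d - 2)))).
have hQ x : is_derive x 1 Q (tent c d x).
  have h := is_deriveZ c^-1 (is_deriveD (is_deriveB (hP d x)
    (is_deriveZ 2 (hP (d - 1) x))) (hP (d - 2) x)).
  apply: (@is_derive_eq _ _ _ _ _ _ _ _ h).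
  rewrite /tent /ramp /GRing.scale /=.
  rewrite -!addrA; have -> : -1 + -1 = - 2 :> R by ring.
  by field; rewrite gt_eqF.
have dQ x : derivable Q x 1 by apply: ex_derive.
have cQ : continuous Q.
  by move=> x; apply: differentiable_continuous; exact/derivable1_diffP.
have QE x : Q x = c^-1 * (P (c * x + d) - 2 * P (c * x + (d - 1)) + P (c * x + (d - 2))).
  by [].
have Q0 : Q 0 = 0.
  rewrite QE /P mulr0 !add0r !pos_part_le0; [|lra..].
  by rewrite expr0n /= mul0r mulr0 subr0 addr0 mulr0.
have Q1 : Q 1 = c^-1.
  rewrite QE /P mulr1 !pos_partE; [|lra..].
  rewrite -[RHS]mulr1; congr (_ * _); by field.
have ict : mu.-integrable `[0%R, 1%R]%classic (EFin \o tent c d).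
  apply: continuous_compact_integrable; first exact: segment_compact.
  by apply: continuous_subspaceT; exact: continuous_tent.
have FTC : \int[mu]_(x in `[0%R, 1%R]) (tent c d x) = c^-1.
  rewrite /Rintegral (@continuous_FTC2 _ _ Q) //.
  - by rewrite Q0 Q1 sube0.
  - by apply: continuous_subspaceT; exact: continuous_tent.
  - split; first by move=> x _; exact: dQ.
      apply: cvg_at_right_filter; exact: cQ.
    apply: cvg_at_left_filter; exact: cQ.
  - by move=> x _; rewrite derive1E; apply: derive_val.
rewrite Rintegral_itv_obnd_cbnd; last first.
  by apply: integrableS ict => //; apply: subset_itv; rewrite bnd_simp.
rewrite Rintegral_itv_bndo_bndc //.
by apply: integrableS ict => //; apply: subset_itv; rewrite bnd_simp.
Qed.

End Tents.

(** * Conditional expectations on the cells of the partition *)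
Section Cells.
Variable R : realType.
Notation mu := (@lebesgue_measure R).
Notation D := (`]0%R, 1%R[%classic : set R).
Notation I := (`[0%R, 1%R]%classic : set R).
Implicit Types (m k l : nat) (x y : R).

(** The n intervals that generate the sigma-algebra, with n = m + 1; the last
    one, k = m, is closed. *)
Definition cell m k : set R :=
  if (k < m)%N then `[k%:R / m.+1%:R, k.+1%:R / m.+1%:R[%classic
  else `[k%:R / m.+1%:R, 1]%classic.

Lemma cell_lower m k x : cell m k x -> k%:R <= m.+1%:R * x.
Proof.
by rewrite /cell; case: ifP => _ /=; rewrite in_itv /= => /andP[+ _];
  rewrite ler_pdivrMr ?ltr0n // mulrC.
Qed.

Lemma cell_upper m k x : (k < m)%N -> cell m k x -> m.+1%:R * x < k.+1%:R.
Proof.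
by rewrite /cell => -> /=; rewrite in_itv /= => /andP[_];
  rewrite ltr_pdivlMr ?ltr0n // mulrC.
Qed.

Lemma in_cell m k x : (k < m)%N ->
  k%:R <= m.+1%:R * x < k.+1%:R -> cell m k x.
Proof.
rewrite /cell => -> /andP[kx xk] /=; rewrite in_itv /=.
by rewrite ler_pdivrMr ?ltr0n // ltr_pdivlMr ?ltr0n // mulrC kx.
Qed.

Lemma in_last_cell m x : m%:R <= m.+1%:R * x -> x <= 1 -> cell m m x.
Proof.
rewrite /cell ltnn => mx x1 /=; rewrite in_itv /= x1 andbT.
by rewrite ler_pdivrMr ?ltr0n // mulrC.
Qed.

Lemma cell_sub m k : (k <= m)%N -> cell m k `<=` I.
Proof.
move=> km x cx; rewrite /= in_itv /=; apply/andP; split.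
  by rewrite -(@pmulr_rge0 _ m.+1%:R) ?ltr0n // (le_trans _ (cell_lower cx)).
have [km'|km'] := ltnP k m.
  rewrite -(@ler_pM2l _ m.+1%:R) ?ltr0n // mulr1.
  by rewrite (le_trans (ltW (cell_upper km' cx))) // ler_nat ltnS.
by move: cx; rewrite /cell ltnNge km' /= in_itv /= => /andP[].
Qed.

Lemma cell_inj m k l x : (k <= m)%N -> (l <= m)%N ->
  cell m k x -> cell m l x -> k = l.
Proof.
wlog kl : k l / (k <= l)%N.
  move=> h km lm ck cl; have [kl|/ltnW lk] := leqP k l; first exact: h.
  by apply/esym; apply: h.
move=> km lm ck cl; apply/eqP; rewrite eqn_leq kl /= leqNgt; apply/negP => kl'.
have := lt_le_trans (cell_upper (leq_trans kl' lm) ck) (le_refl _).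
have := cell_lower cl; move=> /le_lt_trans /[apply].
by rewrite ltr_nat ltnS leqNgt kl'.
Qed.

Lemma measurable_cell m k : measurable (cell m k).
Proof. by rewrite /cell; case: ifP => _; exact: measurable_itv. Qed.

Lemma mu_cell m k : (k <= m)%N -> mu (cell m k) = (m.+1%:R^-1)%:E.
Proof.
move=> km; have m0 : m.+1%:R != 0 :> R by rewrite pnatr_eq0.
rewrite /cell; case: ifP => km'; rewrite lebesgue_measure_itv /= lte_fin.
  rewrite ltr_pM2r ?invr_gt0 ?ltr0n // ltr_nat ltnSn -EFinD; congr EFin.
  by rewrite -natr1; field.
have -> : k = m by apply/eqP; rewrite eqn_leq km leqNgt km'.
rewrite ltr_pdivrMr ?ltr0n // mul1r ltr_nat ltnSn -EFinD; congr EFin.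
by move: m0; rewrite -natr1 => ?; field.
Qed.

Lemma sigma_cell m k : (k <= m)%N -> @sigma_cells R m.+1 (cell m k).
Proof.
move=> km; rewrite /cell; case: ifP => km'.
  by left; exists k => //=; rewrite ltnS.
by right; have -> : k = m by apply/eqP; rewrite eqn_leq km leqNgt km'.
Qed.

Lemma sigma_cellsP m A : @sigma_cells R m.+1 A ->
  exists2 k, (k <= m)%N & A = cell m k.
Proof.
case=> [[k]|->]; last by exists m => //; rewrite /cell ltnn.
by rewrite ltnS => km ->; exists k; rewrite ?(ltnW km) // /cell km.
Qed.

(** The sets that contain, with a point of a cell, the whole cell form a
    sigma-algebra, because the cells lie in the unit interval; it contains each cell since
    distinct cells are disjoint. *)
Lemma sigma_n_atom m A k x y : @sigma_n R m.+1 A -> (k <= m)%N ->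
  cell m k x -> cell m k y -> A x -> A y.
Proof.
move=> sA; pose G : set (set R) := [set A | forall k x y, (k <= m)%N ->
  cell m k x -> cell m k y -> A x -> A y].
suff /(_ _ sA) : @sigma_n R m.+1 `<=` G by apply.
apply: smallest_sub; first split.
- by [].
- move=> B GB l u v lm cu cv [Du nBu]; split; first exact: cell_sub cv.
  by apply: contra_not nBu; exact: GB cu.
- move=> F GF l u v lm cu cv [i _ Fu]; exists i => //.
  exact: GF cu cv Fu.
move=> B /sigma_cellsP[l lm ->] p u v pm cu cv cu'.
by rewrite -(cell_inj pm lm cu cu').
Qed.

Section CondExp.
Variables (m : nat) (f g : R -> R).
Hypothesis gE : is_cond_exp mu I (@sigma_n R m.+1) f g.

(** A fibre of a function measurable for the sigma-algebra belongs to it, so it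
    contains every cell that it meets. *)
Lemma cond_exp_cell_const k x y : (k <= m)%N ->
  cell m k x -> cell m k y -> g x = g y.
Proof.
case: gE => mg _ _ km cx cy.
have sA : sigma_n m.+1 (I `&` g @^-1` [set g x]).
  by apply: mg; exists [set g x] => //; exact: measurable_set1.
by have [] := sigma_n_atom sA km cx cy (conj (cell_sub km cx) erefl).
Qed.

Lemma cond_exp_cell k x : (k <= m)%N -> cell m k x ->
  g x = m.+1%:R * \int[mu]_(y in cell m k) f y.
Proof.
move=> km cx; case: (gE) => _ _ /(_ (cell m k)) fg.
have <- : \int[mu]_(y in cell m k) g y = \int[mu]_(y in cell m k) f y.
  congr fine; apply: fg; apply: sub_sigma_algebra; exact: sigma_cell.
have -> : \int[mu]_(y in cell m k) g y = \int[mu]_(y in cell m k) g x.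
  by apply: eq_Rintegral => y /set_mem cy; exact: (cond_exp_cell_const km).
rewrite Rintegral_cst; last exact: measurable_cell.
rewrite [X in g x * X](_ : _ = m.+1%:R^-1); last exact: (congr1 fine (mu_cell km)).
by rewrite mulrCA mulfV ?mulr1 // pnatr_eq0.
Qed.

End CondExp.

(** Replaces a cell by its interior, which is how it appears in [dtent].  For
    0 < m the left endpoint of the last cell is inside the open unit interval, so
    its two endpoints can be added one at a time. *)
Lemma Rintegral_cell m k (f : R -> R) : (0 < m)%N -> (k <= m)%N ->
  mu.-integrable D (EFin \o f) ->
  \int[mu]_(x in cell m k) f x =
  \int[mu]_(x in D) (f x * \1_(`]0, 1[%classic : set R) (m.+1%:R * x - k%:R)).
Proof.
move=> m0 km if_; have mn0 : 0 < m.+1%:R :> R by rewrite ltr0n.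
have kR : 0 <= k%:R :> R by [].
have kmR : k.+1%:R <= m.+1%:R :> R by rewrite ler_nat ltnS.
pose J := `]k%:R / m.+1%:R, k.+1%:R / m.+1%:R[%classic : set R.
have JD : J `<=` D.
  apply: subset_itv; rewrite bnd_simp; first by rewrite divr_ge0.
  by rewrite ler_pdivrMr // mul1r.
have -> : \int[mu]_(x in D) (f x * \1_(`]0, 1[%classic : set R) (m.+1%:R * x - k%:R))
   = \int[mu]_(x in J) f x.
  rewrite -[in RHS](setIidr JD) Rintegral_mkcondr.
  apply: eq_Rintegral => x _; rewrite patchE indicE.
  have -> : (m.+1%:R * x - k%:R \in (`]0, 1[%classic : set R)) = (x \in J).
    have H : (0 < m.+1%:R * x - k%:R < 1) =
        (k%:R / m.+1%:R < x < k.+1%:R / m.+1%:R).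
      rewrite subr_gt0 ltrBlDr addrC natr1.
      by rewrite ltr_pdivrMr // ltr_pdivlMr // ![x * _]mulrC.
    by apply/idP/idP; rewrite !inE /= !in_itv /= H.
  by case: (x \in J); rewrite ?mulr1 ?mulr0.
rewrite /cell; case: ifP => km'.
  rewrite Rintegral_itv_obnd_cbnd //; exact: integrableS if_.
have kE : k = m by apply/eqP; rewrite eqn_leq km leqNgt km'.
have E1 : k.+1%:R / m.+1%:R = 1 :> R by rewrite kE divff // gt_eqF.
rewrite /J E1 in JD *.
have iJ : mu.-integrable `[k%:R / m.+1%:R, 1[%classic (EFin \o f).
  apply: integrableS if_ => //; apply: subset_itv; rewrite bnd_simp //.
  by rewrite divr_gt0 // ltr0n kE.
rewrite Rintegral_itv_obnd_cbnd; last exact: integrableS if_.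
by rewrite Rintegral_itv_bndo_bndc.
Qed.

End Cells.

(** * The energy of the cell averages *)
Section SquareIntegrable.
Variables (R : realType) (f : R -> R).
Notation mu := (@lebesgue_measure R).
Notation D := (`]0%R, 1%R[%classic : set R).

Hypothesis L2f : L2 D f.

Lemma L2_integrable_sqr : mu.-integrable D (EFin \o (fun x => f x ^+ 2)).
Proof.
have h : mu.-integrable D (EFin \o (fun x => (f \_ D) x ^+ 2)).
  by apply: (@integrableS _ _ _ _ setT) => //; exact: Lfun2_integrable_sqr.
by apply: eq_integrable h => // x xD; rewrite /= patchE xD.
Qed.

Lemma L2_measurable : measurable_fun D f.
Proof.
apply/(measurable_restrictT _ _).2 => //.
by move: L2f; rewrite /L2 inE => /andP[]; rewrite inE.
Qed.

(** On an interval of finite length, by |f| <= 1 + f^2. *)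
Lemma L2_integrable : mu.-integrable D (EFin \o f).
Proof.
apply: (@le_integrable _ _ R mu D (measurable_itv _) (EFin \o f) (EFin \o (fun x => 1 + f x ^+ 2))) => //.
- by apply/measurable_EFinP; exact: L2_measurable.
- move=> x Dx; rewrite /= lee_fin [leRHS]ger0_norm ?addr_ge0 ?sqr_ge0 //.
  rewrite -[f x ^+ 2]real_normK ?num_real //.
  have := normr_ge0 (f x); set y := `|f x|; nra.
- rewrite (_ : _ \o _ = ((EFin \o cst 1%R) \+ (EFin \o (fun x => f x ^+ 2)%R))%E); last first.
    by apply/funext => x; rewrite /= EFinD.
  apply: integrableD => //; last exact: L2_integrable_sqr.
  apply: (@integrableS _ _ R mu `[0%R, 1%R]%classic) => //.
    by apply: subset_itv; rewrite bnd_simp.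
  apply: (@continuous_compact_integrable _ (cst 1)); first exact: segment_compact.
  by apply: continuous_subspaceT => x; exact: cvg_cst.
Qed.

End SquareIntegrable.

Section AverageDifferences.
Variables (R : realType) (f f' : R -> R).
Notation mu := (@lebesgue_measure R).
Notation D := (`]0%R, 1%R[%classic : set R).
Hypothesis Hf : sobolev_H1 D f f'.
Implicit Types (m k : nat).

Definition cell_average m k : R := m.+1%:R * \int[mu]_(y in cell m k) f y.

Let L2f : L2 D f. Proof. by case: Hf. Qed.
Let L2f' : L2 D f'. Proof. by case: Hf. Qed.
Let if_ := L2_integrable L2f.
Let if' := L2_integrable L2f'.
Let ifsq := L2_integrable_sqr L2f'.

(** Up to sign, the difference of the averages over two neighbouring cells is
    the integral of f against the derivative of the tent over their union. *)
Lemma cell_average_diff m k : (k < m)%N ->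
  cell_average m k.+1 - cell_average m k =
  \int[mu]_(x in D) (f' x * tent m.+1%:R (- k%:R) x).
Proof.
move=> km; have m0 : (0 < m)%N by apply: leq_ltn_trans km.
have mR : 0 < m.+1%:R :> R by rewrite ltr0n.
have kR : - k%:R <= 0 :> R by rewrite oppr_le0.
have kmR : 2 <= m.+1%:R - k%:R :> R.
  by rewrite lerBrDr -natrD ler_nat -addn2; lia.
have ind e : measurable_fun D (fun x => \1_(`]0, 1[%classic : set R) (m.+1%:R * x - e) : R).
  apply: measurable_funTS; apply: measurableT_comp (measurable_affine m.+1%:R (- e)).
  exact: measurable_indic.
have indI e : mu.-integrable D
    (EFin \o (fun x => f x * \1_(`]0, 1[%classic : set R) (m.+1%:R * x - e))).
  apply: (@integrable_bounded_mul _ _ R mu D _ _ _ 1); [by []|exact: if_|exact: ind|move=> x].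
  by rewrite indicE; case: (_ \in _); rewrite ?normr1 ?normr0.
case: Hf => _ _ /weak_derivative_tent - /(_ m.+1%:R (- k%:R) if_ if' mR kR kmR).
move=> /(congr1 -%R); rewrite opprK => <-.
rewrite /cell_average !Rintegral_cell // ?(ltnW km) //.
have -> : \int[mu]_(x in D) (f x * dtent m.+1%:R (- k%:R) x) =
    \int[mu]_(x in D) (m.+1%:R * (f x * \1_(`]0, 1[%classic : set R) (m.+1%:R * x - k%:R)
      - f x * \1_(`]0, 1[%classic : set R) (m.+1%:R * x - k.+1%:R))).
  by apply: eq_Rintegral => x _; rewrite /dtent -opprD natr1; ring.
rewrite RintegralZl //; last exact: integrable_funB.
by rewrite RintegralB // -mulrBr -mulrN opprB.
Qed.

Lemma integrable_sqr_tent c d :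
  mu.-integrable D (EFin \o (fun x => f' x ^+ 2 * tent c d x)).
Proof.
apply: (@integrable_bounded_mul _ _ R mu D _ _ _ 1); [by []|exact: ifsq| |].
  by apply: measurable_funTS; exact: measurable_tent.
by move=> x; rewrite ger0_norm ?tent_ge0 ?tent_le1.
Qed.

(** The Cauchy-Schwarz inequality for the weight [tent c d], whose total mass is
    1/c: expand the integral of (f' - c I)^2 against the weight, where I is the
    integral of f' against it. *)
Lemma sqr_Rintegral_tent c d : 0 < c -> d <= 0 -> 2 <= c + d ->
  c * (\int[mu]_(x in D) (f' x * tent c d x)) ^+ 2 <=
  \int[mu]_(x in D) (f' x ^+ 2 * tent c d x).
Proof.
move=> c0 d0 cd2; set I := \int[mu]_(x in D) (f' x * tent c d x).
have mt : measurable_fun D (tent c d).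
  by apply: measurable_funTS; exact: measurable_tent.
have i1 : mu.-integrable D (EFin \o (fun x => f' x * tent c d x)).
  apply: (@integrable_bounded_mul _ _ R mu D _ _ _ 1); [by []|exact: if'|by []|move=> x].
  by rewrite ger0_norm ?tent_ge0 ?tent_le1.
have i0 : mu.-integrable D (EFin \o tent c d).
  apply: (@integrableS _ _ R mu `[0%R, 1%R]%classic) => //.
    by apply: subset_itv; rewrite bnd_simp.
  apply: continuous_compact_integrable; first exact: segment_compact.
  by apply: continuous_subspaceT; exact: continuous_tent.
have i2 := integrable_sqr_tent c d.
have : 0 <= \int[mu]_(x in D) ((f' x - c * I) ^+ 2 * tent c d x).
  by apply: Rintegral_ge0 => x _; rewrite mulr_ge0 ?sqr_ge0 ?tent_ge0.
have -> : \int[mu]_(x in D) ((f' x - c * I) ^+ 2 * tent c d x) =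
  \int[mu]_(x in D) ((f' x ^+ 2 * tent c d x) - ((2 * c * I) * (f' x * tent c d x)
     - (c * I) ^+ 2 * tent c d x)).
  by apply: eq_Rintegral => x _; ring.
have i3 : mu.-integrable D (EFin \o (fun x => 2 * c * I * (f' x * tent c d x))).
  exact: integrable_funZ.
have i4 : mu.-integrable D (EFin \o (fun x => (c * I) ^+ 2 * tent c d x)).
  exact: integrable_funZ.
rewrite RintegralB //; last exact: integrable_funB.
rewrite RintegralB // !RintegralZl //.
rewrite -/I Rintegral_tent // -subr_ge0.
have -> : 2 * c * I * I - (c * I) ^+ 2 / c = c * I ^+ 2.
  by field; rewrite gt_eqF.
by [].
Qed.

(** Consecutive tents add up to at most 1. *)
Lemma sum_Rintegral_sqr_tent_le c m :
  \sum_(0 <= k < m) \int[mu]_(x in D) (f' x ^+ 2 * tent c (- k%:R) x) <=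
  \int[mu]_(x in D) (f' x ^+ 2).
Proof.
have isum p : mu.-integrable D
    (EFin \o (fun x => f' x ^+ 2 * \sum_(0 <= k < p) tent c (- k%:R) x)).
  apply: (@integrable_bounded_mul _ _ R mu D _ _ _ 1); [by []|exact: ifsq| |].
    apply: measurable_sum => k; apply: measurable_funTS; exact: measurable_tent.
  by move=> x; rewrite ger0_norm ?sum_tent_le1 // sumr_ge0 // => k _; exact: tent_ge0.
have -> : \sum_(0 <= k < m) \int[mu]_(x in D) (f' x ^+ 2 * tent c (- k%:R) x) =
    \int[mu]_(x in D) (f' x ^+ 2 * \sum_(0 <= k < m) tent c (- k%:R) x).
  elim: m => [|p IH].
    rewrite big_nil -[LHS](@mul0r _ (fine (mu D))) -Rintegral_cst //.
    by apply: eq_Rintegral => x _; rewrite big_nil mulr0.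
  rewrite big_nat_recr //= IH -RintegralD; [|by []|exact: isum|exact: integrable_sqr_tent].
  by apply: eq_Rintegral => x _; rewrite big_nat_recr //= [RHS]mulrDr.
apply: le_Rintegral; [by []|exact: isum|exact: ifsq|move=> x _].
by rewrite ler_piMr ?sqr_ge0 ?sum_tent_le1.
Qed.

Lemma sum_sqr_cell_average_diff m :
  \sum_(0 <= k < m) m.+1%:R * (cell_average m k.+1 - cell_average m k) ^+ 2 <=
  \int[mu]_(x in D) (f' x ^+ 2).
Proof.
apply: le_trans (sum_Rintegral_sqr_tent_le m.+1%:R m).
rewrite !big_nat; apply: ler_sum => k /andP[_ km].
rewrite cell_average_diff //; apply: sqr_Rintegral_tent.
- by rewrite ltr0n.
- by rewrite oppr_le0.
- by rewrite lerBrDr -natrD ler_nat -addn2; lia.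
Qed.

End AverageDifferences.

(** * The difference quotient as a step function *)
Section DifferenceQuotient.
Variables (R : realType) (m : nat) (f g : R -> R).
Notation mu := (@lebesgue_measure R).
Notation I := (`[0%R, 1%R]%classic : set R).
Hypothesis gE : is_cond_exp mu I (@sigma_n R m.+1) f g.
Notation a := (cell_average f m).

Let dq_sqr k : R := (m.+1%:R * (a k.+1 - a k)) ^+ 2.

Lemma in_cell_exists (x : R) : 0 <= x <= 1 -> exists2 k, (k <= m)%N & cell m k x.
Proof.
move=> /andP[x0 x1]; have nx0 : 0 <= m.+1%:R * x by rewrite mulr_ge0.
have := Num.Theory.truncn_itv nx0; set k := Num.truncn _ => kx.
have [km|mk] := ltnP k m; first by exists k; [exact: ltnW|exact: in_cell].
exists m => //; apply: in_last_cell => //.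
by case/andP: kx => + _; apply: le_trans; rewrite ler_nat.
Qed.

(** Translation by 1/n maps each cell into the next one.  The right endpoint
    x = 1 - 1/n is no exception: it belongs to the last cell, as does x + 1/n = 1,
    so both sides vanish there. *)
Lemma diff_quot_sqrE (x : R) : 0 <= x <= 1 - m.+1%:R^-1 ->
  `|diff_quot m.+1 g x| ^+ 2 =
  \sum_(0 <= k < m) dq_sqr k * \1_(cell m k) x.
Proof.
move=> /andP[x0 x1]; have n0 : 0 < m.+1%:R :> R by rewrite ltr0n.
have ni0 : 0 < m.+1%:R^-1 :> R by rewrite invr_gt0.
have xle1 : x <= 1 by rewrite (le_trans x1) // gerBl ltW.
have [k km ck] : exists2 k, (k <= m)%N & cell m k x.
  by apply: in_cell_exists; rewrite x0.
have ind l : (l <= m)%N -> \1_(cell m l) x = (l == k)%:R :> R.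
  move=> lm; rewrite indicE; congr ((nat_of_bool _)%:R); apply/idP/eqP.
    by rewrite inE => cl; exact: cell_inj cl ck.
  by move=> ->; rewrite inE.
have nx : m.+1%:R * (x + m.+1%:R^-1) = m.+1%:R * x + 1.
  by rewrite mulrDr mulfV // gt_eqF.
have xm : m.+1%:R * x <= m%:R.
  have : m.+1%:R * x <= m.+1%:R * (1 - m.+1%:R^-1) by rewrite ler_pM2l.
  by rewrite mulrBr mulr1 mulfV ?gt_eqF // -natr1 addrK.
rewrite real_normK ?num_real // /diff_quot (cond_exp_cell gE km ck).
have [km'|km'] := ltnP k m; last first.
  have kE : k = m by apply/eqP; rewrite eqn_leq km.
  have cx : cell m m (x + m.+1%:R^-1).
    apply: in_last_cell; last by rewrite -lerBrDr.
    by rewrite nx; have := cell_lower ck; rewrite kE => /le_trans; apply; rewrite lerDl.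
  rewrite (cond_exp_cell gE (leqnn m) cx) kE subrr mulr0 expr0n /=.
  rewrite big_nat big1 // => l /andP[_ lm].
  by rewrite ind ?(ltnW lm) // kE ltn_eqF // mulr0.
have cx : cell m k.+1 (x + m.+1%:R^-1).
  have lo := cell_lower ck; have up := cell_upper km' ck.
  have [km2|km2] := ltnP k.+1 m.
    by apply: in_cell => //; rewrite nx -[k.+2%:R]natr1 -[k.+1%:R]natr1 lerD2r lo ltrD2r natr1.
  have kE : k.+1 = m by apply/eqP; rewrite eqn_leq km2 andbT.
  rewrite kE; apply: in_last_cell; last by rewrite -lerBrDr.
  have -> : m%:R = k%:R + 1 :> R by rewrite natr1 kE.
  by rewrite nx lerD2r.
rewrite (cond_exp_cell gE km' cx).
rewrite (bigD1_seq k) ?mem_index_iota ?iota_uniq //= ind // eqxx mulr1.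
rewrite big1_seq ?addr0 // => l /andP[lk]; rewrite mem_index_iota => /andP[_ lm].
by rewrite ind ?(ltnW lm) // (negbTE lk) mulr0.
Qed.

Lemma integral_diff_quot_sqr_le :
  (\int[mu]_(x in `[0%R, (1 - m.+1%:R^-1)%R]) (`|diff_quot m.+1 g x| ^+ 2)%:E
   <= (\sum_(0 <= k < m) m.+1%:R * (a k.+1 - a k) ^+ 2)%:E)%E.
Proof.
pose J := (`[0%R, (1 - m.+1%:R^-1)%R]%classic : set R).
have mJ : measurable J by exact: measurable_itv.
have -> : (\int[mu]_(x in `[0%R, (1 - m.+1%:R^-1)%R]) (`|diff_quot m.+1 g x| ^+ 2)%:E
  = \int[mu]_(x in J) \sum_(k <- index_iota 0 m) (dq_sqr k * \1_(cell m k) x)%:E)%E.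
  apply: eq_integral => x; rewrite inE /= in_itv /= => xJ.
  by rewrite diff_quot_sqrE // sumEFin.
rewrite ge0_integral_sum //; last 2 first.
- move=> k; apply/measurable_EFinP; apply: measurable_funM => //.
  by apply: measurable_indic; exact: measurable_cell.
- by move=> k x _; rewrite lee_fin mulr_ge0 ?sqr_ge0.
rewrite -sumEFin !big_nat; apply: lee_sum => k /andP[_ km].
have -> : (\int[mu]_(x in J) (dq_sqr k * \1_(cell m k) x)%:E =
    (dq_sqr k)%:E * \int[mu]_(x in J) (\1_(cell m k) x)%:E)%E.
  apply: (@integralZl_indic _ _ R mu J (measurable_itv _) (fun=> cell m k) (dq_sqr k)).
    by rewrite ltNge sqr_ge0.
  exact: measurable_cell.
rewrite integral_indic //; last exact: measurable_cell.
have le_mu : (mu (cell m k `&` J) <= mu (cell m k))%E.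
  apply: le_measure; rewrite ?inE; [|exact: measurable_cell|exact: subIsetl].
  by apply: measurableI; [exact: measurable_cell|exact: measurable_itv].
apply: (@le_trans _ _ ((dq_sqr k)%:E * mu (cell m k))%E).
  by apply: lee_wpmul2l => //; rewrite lee_fin sqr_ge0.
rewrite mu_cell ?(ltnW km) // -EFinM lee_fin le_eqVlt; apply/orP; left; apply/eqP.
have : m.+1%:R != 0 :> R by rewrite pnatr_eq0.
by rewrite /dq_sqr exprMn; move: (m.+1%:R) => N N0; field.
Qed.

End DifferenceQuotient.

Lemma limn_esup_le (R : realType) (u : (\bar R)^nat) (M : \bar R) :
  (\forall n \near \oo, (u n <= M)%E) -> (limn_esup u <= M)%E.
Proof.
move=> [N _ uM]; rewrite limn_esup_lim; apply: lime_le; first exact: is_cvg_esups.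
exists N => // n /= Nn; apply: ge_ereal_sup => _ [k /= nk <-].
by apply: uM; exact: leq_trans nk.
Qed.

Unset Implicit Arguments.

Theorem lemma14 (R : realType) (f f' : R -> R) (ftilde : nat -> R -> R)
    (Hf : sobolev_H1 `]0, 1[ f f')
    (Hftilde : forall n : nat, (0 < n)%N ->
       is_cond_exp (@lebesgue_measure R) `[0, 1] (@sigma_n R n) f (ftilde n)) :
  (limn_esup (fun n : nat =>
     \int[@lebesgue_measure R]_(x in `[0%R, (1 - n%:R^-1)%R])
       (`|diff_quot n (ftilde n) x| ^+ 2)%:E)
   <= \int[@lebesgue_measure R]_(x in `]0%R, 1%R[) (`|f' x| ^+ 2)%:E)%E.
Proof.
apply: limn_esup_le; exists 1%N => // -[//|m] _.
apply: le_trans (integral_diff_quot_sqr_le (Hftilde m.+1 isT)) _.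
have -> : (\int[@lebesgue_measure R]_(x in `]0%R, 1%R[) (`|f' x| ^+ 2)%:E
   = (\int[@lebesgue_measure R]_(x in `]0%R, 1%R[) (f' x ^+ 2))%:E)%E.
  rewrite /Rintegral fineK.
    by apply: eq_integral => x _; rewrite real_normK ?num_real.
  apply: integrable_fin_num => //.
  by case: Hf => _ + _; exact: L2_integrable_sqr.
by rewrite lee_fin; exact: sum_sqr_cell_average_diff Hf m.
Qed.
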